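(* Let $(S, A, \{P_{ss'}^a\}, \{r_s^a\})$ be a finite Markov decision process, let $c \in (0,1)$, let $R = \max_{s,s' \in S,\, a \in A} |r_s^a - r_{s'}^a|$, and let $\mathcal{V}$ be the set of functions $h : S \times S \to \mathbb{R}$ that are bounded by $\frac{R}{1-c}$, with uniform norm $\|\cdot\|$. For each $i \geq 1$ define $F_i^c : \mathcal{V} \to \mathcal{V}$ by $$F_i^c(h)(s,s') = \max_{a \in A}\left(|r_s^a - r_{s'}^a| + c\,T_K^i(h)(P_s^a, P_{s'}^a)\right),$$ where $T_K^i(h)(P_s^a,P_{s'}^a)$ denotes the Kantorovich functional $T_K(h)$ evaluated at the $i$-sample empirical distributions of $P_s^a$ and $P_{s'}^a$. Then: 1. $F_i^c$ has a unique fixed point $d_i^c$ (in $\mathcal{V}$); 2. for any $h_0 \in \mathcal{V}$ and any $n \geq 0$, $\|d_i^c - (F_i^c)^n(h_0)\| \leq \frac{c^n}{1-c}\|F_i^c(h_0) - h_0\|$; 3. as $i \to \infty$, $d_i^c$ converges to $d_{fix}^c$ in uniform norm, almost surely, where $d_{fix}^c$ is the unique fixed point in $\mathcal{V}$ of the map $F^c : \mathcal{V} \to \mathcal{V}$, $F^c(h)(s,s') = \max_{a \in A}\left(|r_s^a - r_{s'}^a| + c\,T_K(h)(P_s^a, P_{s'}^a)\right)$.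
   Context: A finite Markov decision process $(S, A, \{P_{ss'}^a\}, \{r_s^a\})$ consists of a finite (nonempty) set $S$ of states, a finite (nonempty) set $A$ of actions, for each $s \in S$, $a \in A$ a probability distribution $P_s^a = (P_{ss'}^a)_{s' \in S}$ on $S$ (the probability of transitioning from $s$ to $s'$ under $a$), and real rewards $r_s^a$. A function $h$ on $S\times S$ is bounded by $M$ if $|h(s,s')| \le M$ for all $s,s'$; the uniform norm is $\|h\| = \max_{s,s'\in S} |h(s,s')|$. Kantorovich functional: for a function $h : S \times S \to \mathbb{R}$ and probability distributions $P, Q$ on $S$, $$T_K(h)(P,Q) = \min_{\lambda} \sum_{x,y \in S} \lambda(x,y)\, h(x,y),$$ where the minimum is over all $\lambda : S \times S \to [0,\infty)$ with $\sum_{y} \lambda(x,y) = P(x)$ for all $x \in S$ and $\sum_{x} \lambda(x,y) = Q(y)$ for all $y \in S$. Empirical distributions: for each $s \in S$ and $a \in A$, let $X_1, X_2, \ldots$ be a sequence of independent $S$-valued random variables with distribution $P_s^a$ (all sequences, for all $s$ and $a$, are defined on a common probability space). The $i$-sample empirical distribution of $P_s^a$ is $(P_s^a)_i(x) = \frac{1}{i}\sum_{k=1}^i \delta_{X_k}(x)$, where $\delta_{X_k}(x) = 1$ if $X_k = x$ and $0$ otherwise. One writes $T_K^i(h)(P_s^a, P_{s'}^a) = T_K(h)((P_s^a)_i, (P_{s'}^a)_i)$. The maps $F_i^c$ and their fixed points $d_i^c$ thus depend on the realization of the samples; items 1 and 2 are for fixed empirical distributions, and ''almost surely'' in item 3 refers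 to the probability space carrying the samples. Known fact: $F^c$ maps $\mathcal{V}$ to $\mathcal{V}$ and has a unique fixed point in $\mathcal{V}$, denoted $d_{fix}^c$. *)

(* Defs.v *)
From HB Require Import structures.
From mathcomp Require Import all_boot all_order all_algebra.
From mathcomp Require Import all_classical all_reals all_analysis.

Set Implicit Arguments.
Unset Strict Implicit.
Unset Printing Implicit Defensive.

Import Order.TTheory GRing.Theory Num.Theory.
Import numFieldNormedType.Exports.

Local Open Scope classical_set_scope.
Local Open Scope ring_scope.

(* The junk value 0 is only taken when T is empty: the maximum of a family of
   negative numbers is negative, so 0 cannot be used as the unit of the big
   operator. *)
Definition finmax (R : realType) (T : finType) (f : T -> R) : R :=
  if [pick t : T] is Some t0 then \big[Num.max/f t0]_(t : T) f t else 0.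

Lemma finmax_max (R : realType) (T : finType) (f : T -> R) :
  (0 < #|T|)%N ->
  (exists t, finmax f = f t) /\ (forall t, f t <= finmax f).
Proof.
move=> /card_gt0P[t1 _]; rewrite /finmax; case: pickP => [t0 _|/(_ t1)//].
split; last by move=> t; exact: le_bigmax.
by elim/big_ind: _ => [|x y [s ->] [t ->]|t _]; [exists t0| |exists t];
  rewrite // /Order.max; case: ifP => _; [exists t|exists s].
Qed.

Definition distribution (R : realType) (S : finType) (p : S -> R) : Prop :=
  (forall x, 0 <= p x) /\ \sum_x p x = 1.

Record mdp (R : realType) (S A : finType) := Mdp {
  trans : S -> A -> S -> R;
  reward : S -> A -> R;
  state_nonempty : (0 < #|S|)%N;
  action_nonempty : (0 < #|A|)%N;
  trans_distribution : forall s a, distribution (trans s a)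
}.

Definition reward_gap (R : realType) (S A : finType) (M : mdp R S A) : R :=
  finmax (fun t : S * S * A => `|reward M t.1.1 t.2 - reward M t.1.2 t.2|).

Definition unif_norm (R : realType) (S : finType) (h : S -> S -> R) : R :=
  finmax (fun t : S * S => `|h t.1 t.2|).

Definition bounded_by (R : realType) (S : finType) (b : R) :
    set (S -> S -> R) :=
  [set h | forall s s', `|h s s'| <= b].

Definition couplings (R : realType) (S : finType) (P Q : S -> R) :
    set (S * S -> R) :=
  [set lam | [/\ forall t, 0 <= lam t,
                 forall x, \sum_y lam (x, y) = P x &
                 forall y, \sum_x lam (x, y) = Q y]].

Definition transport_cost (R : realType) (S : finType) (h : S -> S -> R)
    (lam : S * S -> R) : R :=
  \sum_x \sum_y lam (x, y) * h x y.

(* For distributions P and Q this infimum is a minimum, see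
   kantorovich_min. *)
Definition kantorovich (R : realType) (S : finType) (h : S -> S -> R)
    (P Q : S -> R) : R :=
  inf [set transport_cost h lam | lam in couplings P Q].

Lemma kantorovich_min (R : realType) (S : finType) (h : S -> S -> R)
    (P Q : S -> R) : distribution P -> distribution Q ->
  (exists2 lam, couplings P Q lam & kantorovich h P Q = transport_cost h lam) /\
  (forall lam, couplings P Q lam -> kantorovich h P Q <= transport_cost h lam).
Proof.
move=> [P0 P1] [Q0 Q1].
have sumC (U : topologicalType) (I : finType) (F : I -> U -> R) :
    (forall i, continuous (F i)) -> continuous (fun u : U => \sum_i F i u).
  by move=> FC; apply: continuous_big => [|i _]; [exact: add_continuous|exact: FC].
have genC (U : topologicalType) (ev : S * S -> U -> R) :
    (forall t, continuous (ev t)) ->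
    continuous (fun u : U => \sum_x \sum_y ev (x, y) u * h x y).
  move=> evC; apply: (sumC U S (fun x u => \sum_y ev (x, y) u * h x y)) => x.
  apply: (sumC U S (fun y u => ev (x, y) u * h x y)) => y u.
  by apply: cvgMr_tmp; exact: evC.
pose T : topologicalType := prod_topology (fun _ : S * S => (R : topologicalType)).
have evC (t : S * S) : continuous (fun lam : T => lam t).
  exact: (@proj_continuous _ (fun _ : S * S => (R : topologicalType)) t).
pose C : set T := couplings P Q.
have C0 : C !=set0.
  exists (fun t => P t.1 * Q t.2); split=> [t|x|y] /=; first exact: mulr_ge0.
    by rewrite -mulr_sumr Q1 mulr1.
  by rewrite -mulr_suml P1 mul1r.
pose K : set T := [set f | forall t, (`[0, 1]%classic : set R) (f t)].
have Kc : compact K.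
  apply: (@tychonoff _ (fun _ : S * S => (R : topologicalType))
    (fun _ => `[0, 1]%classic : set R)) => t; exact: segment_compact.
have CK : C `<=` K.
  move=> lam [l0 lP _] [x y] /=; rewrite in_itv /= l0 /=.
  have Px : P x <= 1 by rewrite -P1 (bigD1 x)//= lerDl sumr_ge0.
  by apply: le_trans Px; rewrite -lP (bigD1 y)//= lerDl sumr_ge0.
have Cc : closed C.
  have -> : C = (\bigcap_t ((fun lam : T => lam t) @^-1` [set r : R | 0 <= r])) `&`
    ((\bigcap_x ((fun lam : T => \sum_y lam (x, y)) @^-1` [set r : R | r = P x])) `&`
     (\bigcap_y ((fun lam : T => \sum_x lam (x, y)) @^-1` [set r : R | r = Q y]))).
    apply/seteqP; split=> lam.
      by move=> [l0 lP lQ]; split=> [t _|]; [exact: l0|split=> t _; [exact: lP|exact: lQ]].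
    by move=> [l0 [lP lQ]]; split=> t; [exact: l0|exact: lP|exact: lQ].
  apply: closedI; [|apply: closedI]; apply: closed_bigI => t _;
    apply: (continuous_closedP _).1 => //.
  - by apply: (sumC T S (fun y lam => lam (t, y))) => y; exact: evC.
  - by apply: (sumC T S (fun x lam => lam (x, t))) => x; exact: evC.
have Ccompact : compact C by apply: (subclosed_compact Cc Kc CK).
have costC : continuous (fun lam : T => \sum_x \sum_y lam (x, y) * h x y : R).
  exact: (genC T (fun t lam => lam t) evC).
have minC (U : topologicalType) (D : set U) (f : U -> R) :
    D !=set0 -> compact D -> continuous f ->
    exists2 l, D l & forall k, D k -> f l <= f k.
  move=> D0 Dc fc.
  have [l lD lm] := compact_EVT_min D0 Dc (continuous_subspaceT fc).
  by exists l; [exact: set_mem|move=> k kD; apply: lm; exact: mem_set].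
have [lam lamC lam_min] := minC T C _ C0 Ccompact costC.
have lb : lbound [set transport_cost h l | l in couplings P Q]
    (transport_cost h lam).
  by move=> _ [l lC <-]; apply: lam_min.
have -> : kantorovich h P Q = transport_cost h lam.
  apply/eqP; rewrite eq_le; apply/andP; split.
    by apply: ge_inf; [exists (transport_cost h lam)|exists lam].
  by apply: lb_le_inf => //; exists (transport_cost h lam), lam.
by split; [exists lam|move=> l lC; apply: lb; exists l].
Qed.

(* T s a plays the role of P_s^a: it is trans M for F^c, and the empirical
   distributions for F_i^c. *)
Definition bellman (R : realType) (S A : finType) (M : mdp R S A) (c : R)
    (T : S -> A -> S -> R) (h : S -> S -> R) : S -> S -> R :=
  fun s s' => finmax (fun a : A =>
    `|reward M s a - reward M s' a| + c * kantorovich h (T s a) (T s' a)).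

Definition is_fixpoint (X : Type) (V : set X) (F : X -> X) (x : X) : Prop :=
  V x /\ F x = x.

(* X k is the sample usually numbered k + 1. *)
Definition empirical (R : realType) (S : finType) (Omega : Type)
    (X : nat -> Omega -> S) (i : nat) (w : Omega) : S -> R :=
  fun x => i%:R^-1 * \sum_(k < i) (X k w == x)%:R.

Record iid_samples (R : realType) (d : measure_display)
    (Omega : measurableType d) (Pr : probability Omega R) (S : finType)
    (p : S -> R) (X : nat -> Omega -> S) : Prop := IidSamples {
  sample_measurable : forall k x, measurable (X k @^-1` [set x]);
  sample_law : forall k x, Pr (X k @^-1` [set x]) = (p x)%:E;
  sample_independent : forall (J : seq nat) (B : nat -> set S), uniq J ->
    Pr (\bigcap_(k in [set` J]) (X k @^-1` B k)) =
      (\prod_(k <- J) fine (Pr (X k @^-1` B k)))%:E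
}.

(* Main.v *)
(* The Bellman operator F satisfies: h <= h' + e pointwise implies
   F h <= F h' + c e.  This makes F monotone, so a fixed point exists by
   Knaster-Tarski, and a c-contraction, which gives uniqueness and the error
   bounds.  For the limit, ||d_i - d_fix|| <= ||F_i d_fix - d_fix|| / (1 - c),
   and the right-hand side is controlled by the l^1 distance between empirical
   and true distributions, since an optimal coupling for one pair of marginals
   can be shrunk and completed into a coupling for a nearby pair at a cost
   linear in that distance.  The empirical distributions converge almost surely
   by a strong law for pairwise independent events: along the squares the second
   moments of the deviations are summable, and between consecutive squares the
   means vary little. *)
Require Import Defs.
From mathcomp Require Import all_boot all_order all_algebra.
From mathcomp Require Import all_classical all_reals all_analysis.
From mathcomp Require Import measurable_realfun.
From mathcomp Require Import ring lra zify.

Set Implicit Arguments.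
Unset Strict Implicit.
Unset Printing Implicit Defensive.

Import Order.TTheory GRing.Theory Num.Theory.
Import numFieldNormedType.Exports.

Local Open Scope classical_set_scope.
Local Open Scope ring_scope.

(** * Maxima over finite types and the uniform norm *)

Section finmax.
Context {R : realType} {T : finType}.
Hypothesis T_gt0 : (0 < #|T|)%N.
Implicit Types f g : T -> R.

Lemma finmax_ge f t : f t <= finmax f.
Proof. exact: (finmax_max f T_gt0).2. Qed.

Lemma finmax_le f b : (forall t, f t <= b) -> finmax f <= b.
Proof. by move=> fb; have [[t ->] _] := finmax_max f T_gt0. Qed.

Lemma finmax_leD f g e : (forall t, f t <= g t + e) -> finmax f <= finmax g + e.
Proof.
by move=> fg; apply: finmax_le => t; rewrite (le_trans (fg t))// lerD2r finmax_ge.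
Qed.

End finmax.

Section unif_norm.
Context {R : realType} {S : finType}.
Hypothesis S_gt0 : (0 < #|S|)%N.
Implicit Type h : S -> S -> R.

Lemma unif_norm_ge h s s' : `|h s s'| <= unif_norm h.
Proof.
apply: (@finmax_ge _ _ _ (fun t : S * S => `|h t.1 t.2|) (s, s')).
by rewrite card_prod muln_gt0 S_gt0.
Qed.

Lemma unif_norm_le h b : (forall s s', `|h s s'| <= b) -> unif_norm h <= b.
Proof.
by move=> hb; apply: finmax_le => [|t//]; rewrite card_prod muln_gt0 S_gt0.
Qed.

Lemma unif_norm_ge0 h : 0 <= unif_norm h.
Proof. by move/card_gt0P: S_gt0 => [s _]; exact: le_trans (unif_norm_ge h s s). Qed.

End unif_norm.

(** * The Kantorovich functional: dependence on the cost and on the marginals *)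

Section kantorovich.
Context {R : realType} {S : finType}.
Implicit Types (h : S -> S -> R) (P Q : S -> R) (lam m : S * S -> R).

Lemma coupling_mass P Q lam : Defs.distribution P -> couplings P Q lam ->
  \sum_x \sum_y lam (x, y) = 1.
Proof. by move=> [_ <-] [_ lP _]; apply: eq_bigr => x _. Qed.

Lemma transport_cost_leD h h' P Q lam e :
  Defs.distribution P -> couplings P Q lam -> (forall x y, h x y <= h' x y + e) ->
  transport_cost h lam <= transport_cost h' lam + e.
Proof.
move=> dP Clam hh'; have [l0 _ _] := Clam.
rewrite -[e in leRHS]mul1r -(coupling_mass dP Clam) mulr_suml -big_split/=.
apply: ler_sum => x _; rewrite mulr_suml -big_split/=; apply: ler_sum => y _.
by rewrite -mulrDr ler_wpM2l.
Qed.

(** An optimal coupling for [h'] is also a candidate for [h], and since its mass is 1 the constant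
    [e] costs exactly [e]. *)
Lemma kantorovich_leD h h' P Q e :
  Defs.distribution P -> Defs.distribution Q -> (forall x y, h x y <= h' x y + e) ->
  kantorovich h P Q <= kantorovich h' P Q + e.
Proof.
move=> dP dQ hh'; have [[lam Clam ->] _] := kantorovich_min h' dP dQ.
have [_ /(_ _ Clam) le_lam] := kantorovich_min h dP dQ.
exact: le_trans le_lam (transport_cost_leD dP Clam hh').
Qed.

Lemma kantorovich_cst e P Q : Defs.distribution P -> Defs.distribution Q ->
  kantorovich (fun _ _ => e) P Q = e.
Proof.
move=> dP dQ; have [[lam Clam ->] _] := kantorovich_min (fun _ _ => e) dP dQ.
rewrite -[RHS]mul1r -(coupling_mass dP Clam) mulr_suml.
by apply: eq_bigr => x _; rewrite mulr_suml.
Qed.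

(** By monotonicity in the cost, it suffices to compare [h] with the constant costs [- b] and
    [b]. *)
Lemma kantorovich_bounded h b P Q : Defs.distribution P -> Defs.distribution Q ->
  (forall x y, `|h x y| <= b) -> `|kantorovich h P Q| <= b.
Proof.
move=> dP dQ hb; have {}hb x y : - b <= h x y <= b by rewrite -ler_norml.
rewrite ler_norml; apply/andP; split.
  rewrite -subr_ge0 -(kantorovich_cst (- b) dP dQ) subr_ge0 -[leRHS]addr0.
  by apply: kantorovich_leD => // x y; have /andP[] := hb x y; rewrite addr0.
rewrite -[leRHS](kantorovich_cst b dP dQ) -[leRHS]addr0.
by apply: kantorovich_leD => // x y; have /andP[] := hb x y; rewrite addr0.
Qed.

(* The missing mass is distributed according to the product of the deficits of
   the two marginals, which have the same total mass. *)
Lemma subcoupling_extend P Q m : Defs.distribution P -> Defs.distribution Q ->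
  (forall t, 0 <= m t) -> (forall x, \sum_y m (x, y) <= P x) ->
  (forall y, \sum_x m (x, y) <= Q y) ->
  exists2 lam, couplings P Q lam & forall t, m t <= lam t.
Proof.
move=> [P0 P1] [Q0 Q1] m0 mP mQ.
pose p x := P x - \sum_y m (x, y); pose q y := Q y - \sum_x m (x, y).
have p0 x : 0 <= p x by rewrite subr_ge0.
have q0 y : 0 <= q y by rewrite subr_ge0.
pose D := \sum_x p x.
have Dq : \sum_y q y = D.
  by rewrite /D /p /q !sumrB P1 Q1 exchange_big.
have D0 : 0 <= D by exact: sumr_ge0.
exists (fun t => m t + p t.1 * q t.2 / D) => [|t]; last first.
  by rewrite lerDl divr_ge0// mulr_ge0.
split=> [t|x|y] /=; first by rewrite addr_ge0// divr_ge0// mulr_ge0.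
- rewrite big_split/= -mulr_suml -mulr_sumr Dq.
  (* If [D = 0], the added term is 0 because division by 0 yields 0; the deficits are non-negative
     with sum 0, so they vanish and [m] already has the right marginal. *)
  have [DZ|DN] := eqVneq D 0; last by rewrite mulfK// /p addrC subrK.
  have /eqP := psumr_eq0P (fun i _ => p0 i) DZ (erefl : xpredT x).
  by rewrite subr_eq0 DZ invr0 mulr0 addr0 => /eqP.
- rewrite big_split/= -mulr_suml -mulr_suml -/D.
  have [DZ|DN] := eqVneq D 0.
    have /eqP := psumr_eq0P (fun i _ => q0 i) (etrans Dq DZ) (erefl : xpredT y).
    by rewrite subr_eq0 DZ invr0 mulr0 addr0 => /eqP.
  by rewrite mulrAC mulfV// mul1r /q addrC subrK.
Qed.

(** The factor is 1 if [p <= p'] and [p' / p] otherwise, so that the loss [p * (1 - a)] is the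
    positive part of [p - p']. *)
Lemma shrinking_factor (p p' : R) : 0 <= p -> 0 <= p' ->
  exists a, [/\ 0 <= a, a <= 1, p * a <= p' & p * (1 - a) <= `|p - p'|].
Proof.
move=> p0 p'0; have [pp'|p'p] := leP p p'.
  by exists 1; rewrite mulr1 subrr mulr0; split.
have p_gt0 : 0 < p by exact: le_lt_trans p'p.
exists (p' / p); rewrite mulrBr mulr1 mulrCA mulfV ?gt_eqF// mulr1.
by rewrite divr_ge0// ler_pdivrMr// mul1r ltW// ler_norm.
Qed.

(** An optimal coupling [lam] of [P] and [Q] is scaled by row and column factors until it fits under
    [P'] and [Q'], then completed to a coupling [lam']. The mass removed equals the mass added and
    is at most the sum of the two l^1 distances; each unit of either costs at most [b], whence the
    factor [2 * b]. *)
Lemma kantorovich_perturb h b P Q P' Q' :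
  Defs.distribution P -> Defs.distribution Q ->
  Defs.distribution P' -> Defs.distribution Q' ->
  (forall x y, `|h x y| <= b) ->
  kantorovich h P' Q' <= kantorovich h P Q +
    2 * b * (\sum_x `|P x - P' x| + \sum_y `|Q y - Q' y|).
Proof.
move=> dP dQ dP' dQ' hb.
have [[lam Clam ->] _] := kantorovich_min h dP dQ.
have [l0 lP lQ] := Clam.
have [a Ha] := choice (fun x => shrinking_factor (dP.1 x) (dP'.1 x)).
have [e He] := choice (fun y => shrinking_factor (dQ.1 y) (dQ'.1 y)).
pose m t := lam t * (a t.1 * e t.2).
have m0 t : 0 <= m t.
  have [a0 _ _ _] := Ha t.1; have [e0 _ _ _] := He t.2.
  by rewrite mulr_ge0// mulr_ge0.
have mP x : \sum_y m (x, y) <= P' x.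
  have [a0 _ aP _] := Ha x; apply: le_trans aP; rewrite -lP mulr_suml.
  apply: ler_sum => y _; have [_ e1 _ _] := He y.
  by rewrite ler_wpM2l//= ler_piMr.
have mQ y : \sum_x m (x, y) <= Q' y.
  have [e0 _ eQ _] := He y; apply: le_trans eQ; rewrite -lQ mulr_suml.
  apply: ler_sum => x _; have [_ a1 _ _] := Ha x.
  by rewrite ler_wpM2l//= ler_piMl.
have [lam' Clam' m_lam'] := subcoupling_extend dP' dQ' m0 mP mQ.
have m_lam t : m t <= lam t.
  have [a0 a1 _ _] := Ha t.1; have [e0 e1 _ _] := He t.2.
  by rewrite ler_piMr// mulr_ile1.
have [_ /(_ _ Clam') /le_trans] := kantorovich_min h dP' dQ'; apply.
(* [P] has total mass 1, so [S] has a point, where [b] dominates an absolute value. *)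
have b0 : 0 <= b.
  have [x _] : exists x, x \in [set: S].
    apply: contrapT => nS; have := dP.2.
    rewrite big1 => [/esym/eqP|x]; first by rewrite oner_eq0.
    by exfalso; apply: nS; exists x; rewrite inE.
  exact: le_trans (hb x x).
have lost : \sum_x \sum_y (lam (x, y) - m (x, y)) <=
    \sum_x `|P x - P' x| + \sum_y `|Q y - Q' y|.
  apply: (@le_trans _ _ (\sum_x \sum_y (lam (x, y) * (1 - a x) +
      lam (x, y) * (1 - e y)))).
    apply: ler_sum => x _; apply: ler_sum => y _.
    have [_ a1 _ _] := Ha x; have [_ e1 _ _] := He y.
    rewrite -mulrDr -[X in X - _]mulr1 -mulrBr ler_wpM2l//= -subr_ge0.
    (* The loss [1 - a x * e y] is at most the sum of the row loss and the column loss, with this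
       product as the gap. *)
    rewrite (_ : _ - _ = (1 - a x) * (1 - e y)); last by ring.
    by rewrite mulr_ge0// subr_ge0.
  under eq_bigr do rewrite big_split/=.
  rewrite big_split/= lerD//.
    by apply: ler_sum => x _; rewrite -mulr_suml lP; have [] := Ha x.
  rewrite exchange_big/=; apply: ler_sum => y _.
  by rewrite -mulr_suml lQ; have [] := He y.
(* Both couplings have mass 1, so completing restores exactly the mass that shrinking removed. *)
have lost' : \sum_x \sum_y (lam' (x, y) - m (x, y)) =
    \sum_x \sum_y (lam (x, y) - m (x, y)).
  under eq_bigr do rewrite sumrB.
  under [in RHS]eq_bigr do rewrite sumrB.
  by rewrite !sumrB (coupling_mass dP Clam) (coupling_mass dP' Clam').
apply: (@le_trans _ _ (transport_cost h lam + b * (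
    \sum_x \sum_y (lam' (x, y) - m (x, y)) +
    \sum_x \sum_y (lam (x, y) - m (x, y))))).
  rewrite -big_split/= mulr_sumr -big_split/=; apply: ler_sum => x _.
  rewrite -big_split/= mulr_sumr -big_split/=; apply: ler_sum => y _.
  have := hb x y; rewrite ler_norml => /andP[hb1 hb2].
  have := m_lam (x, y); have := m_lam' (x, y).
  rewrite -subr_ge0 => u0; rewrite -subr_ge0 => v0.
  rewrite -subr_ge0.
  (* All four factors are non-negative: [m] lies below both couplings and [h] lies between [- b] and
     [b]. *)
  rewrite (_ : _ - _ = (lam' (x, y) - m (x, y)) * (b - h x y) +
    (lam (x, y) - m (x, y)) * (b + h x y)); last by ring.
  by rewrite addr_ge0// mulr_ge0//; lra.
by rewrite lost' lerD2l [2 * b]mulrC -mulrA ler_wpM2l// mulr_natl mulr2n lerD.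
Qed.

Lemma kantorovich_dist_le h b P Q P' Q' :
  Defs.distribution P -> Defs.distribution Q ->
  Defs.distribution P' -> Defs.distribution Q' ->
  (forall x y, `|h x y| <= b) ->
  `|kantorovich h P Q - kantorovich h P' Q'| <=
    2 * b * (\sum_x `|P x - P' x| + \sum_y `|Q y - Q' y|).
Proof.
move=> dP dQ dP' dQ' hb; rewrite ler_distl lerBlDr kantorovich_perturb//=.
rewrite (eq_bigr _ (fun x _ => distrC (P x) (P' x))).
rewrite [X in _ * (_ + X)](eq_bigr _ (fun y _ => distrC (Q y) (Q' y))).
exact: kantorovich_perturb.
Qed.

End kantorovich.

(** * The Bellman operator: invariance, contraction, fixed points, perturbation *)

Section bellman.
Context {R : realType} {S A : finType} {M : mdp R S A} {c : R}.
Hypotheses (c_gt0 : 0 < c) (c_lt1 : c < 1).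
Implicit Types (T : S -> A -> S -> R) (h : S -> S -> R).

Let B := reward_gap M / (1 - c).
Let V : set (S -> S -> R) := bounded_by B.

Lemma reward_gap_ge s s' a : `|reward M s a - reward M s' a| <= reward_gap M.
Proof.
apply: (@finmax_ge _ _ _ (fun t : S * S * A =>
  `|reward M t.1.1 t.2 - reward M t.1.2 t.2|) (s, s', a)).
by rewrite !card_prod !muln_gt0 (state_nonempty M) (action_nonempty M).
Qed.

Lemma bellman_leD T h h' e : (forall s a, Defs.distribution (T s a)) ->
  (forall s s', h s s' <= h' s s' + e) ->
  forall s s', bellman M c T h s s' <= bellman M c T h' s s' + c * e.
Proof.
move=> dT hh' s s'; apply: finmax_leD; first exact: action_nonempty M.
move=> a; rewrite -addrA lerD2l -mulrDr ler_wpM2l ?(ltW c_gt0)//.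
exact: kantorovich_leD.
Qed.

Lemma bellman_contraction T h h' : (forall s a, Defs.distribution (T s a)) ->
  unif_norm (fun s s' => bellman M c T h s s' - bellman M c T h' s s') <=
  c * unif_norm (fun s s' => h s s' - h' s s').
Proof.
move=> dT; have S0 := state_nonempty M; apply: unif_norm_le => // s s'.
have le_norm (x y : S) := unif_norm_ge S0 (fun s s' => h s s' - h' s s') x y.
rewrite ler_distl lerBlDr; apply/andP; split.
  apply: bellman_leD => // x y.
  by rewrite -lerBlDl (le_trans _ (le_norm x y))// distrC ler_norm.
apply: bellman_leD => // x y.
by rewrite -lerBlDl (le_trans _ (le_norm x y))// ler_norm.
Qed.

Lemma bellman_bounded T : (forall s a, Defs.distribution (T s a)) ->
  set_fun V V (bellman M c T).
Proof.
move=> dT h Vh s s'.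
have A0 := action_nonempty M; have S0 := state_nonempty M.
(* This is the reason for the radius [B]: it solves [reward_gap M + c * B = B]. *)
have BE : reward_gap M = (1 - c) * B by rewrite mulrC divfK// subr_eq0 gt_eqF.
have B0 : 0 <= B by exact: le_trans (Vh s s').
have cK a : `|c * kantorovich h (T s a) (T s' a)| <= c * B.
  by rewrite normrM gtr0_norm// ler_pM2l// kantorovich_bounded.
rewrite ler_norml; apply/andP; split; last first.
  apply: finmax_le => // a; have := reward_gap_ge s s' a.
  by have := cK a; rewrite BE ler_norml => /andP[]; lra.
(* For the lower bound any single action will do: its value is at least [- (c * B)], hence at least
   [- B]. *)
case/card_gt0P: (A0) => a _.
apply: le_trans (finmax_ge A0 _ a); have := cK a; rewrite ler_norml => /andP[cK1 _].
have := normr_ge0 (reward M s a - reward M s' a).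
have : 0 <= (1 - c) * B by rewrite mulr_ge0// subr_ge0 ltW.
lra.
Qed.

(** Both marginals change by at most [e] in l^1 distance, so the Kantorovich term changes by at most
    [2 * b * (e + e)]. *)
Lemma bellman_perturb T T' h b e :
  (forall s a, Defs.distribution (T s a)) -> (forall s a, Defs.distribution (T' s a)) ->
  (forall s s', `|h s s'| <= b) ->
  (forall s a, \sum_x `|T s a x - T' s a x| <= e) ->
  unif_norm (fun s s' => bellman M c T h s s' - bellman M c T' h s s') <=
  c * (4 * b * e).
Proof.
move=> dT dT' hb Te; apply: unif_norm_le => [|s s']; first exact: state_nonempty M.
have b0 : 0 <= b by exact: le_trans (hb s s).
have K a : `|kantorovich h (T s a) (T s' a) - kantorovich h (T' s a) (T' s' a)| <=
    4 * b * e.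
  apply: le_trans (kantorovich_dist_le _ _ _ _ hb) _ => //.
  rewrite (_ : 4 * b * e = 2 * b * (e + e)); last by ring.
  by rewrite ler_wpM2l ?mulr_ge0// lerD.
rewrite ler_distl lerBlDr; apply/andP; split.
  apply: finmax_leD; first exact: action_nonempty M.
  move=> a; rewrite -addrA lerD2l -mulrDr ler_pM2l// -lerBlDl.
  by rewrite (le_trans _ (K a))// distrC ler_norm.
apply: finmax_leD; first exact: action_nonempty M.
move=> a; rewrite -addrA lerD2l -mulrDr ler_pM2l// -lerBlDl.
by rewrite (le_trans _ (K a))// ler_norm.
Qed.

(* Knaster-Tarski: the pointwise supremum of the post-fixed points. *)
Lemma bellman_fixpoint_exists T : (forall s a, Defs.distribution (T s a)) ->
  exists h, is_fixpoint V (bellman M c T) h.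
Proof.
move=> dT; pose F := bellman M c T.
have FV := bellman_bounded dT.
have monoF h h' : (forall s s', h s s' <= h' s s') ->
    forall s s', F h s s' <= F h' s s'.
  move=> hh' s s'; rewrite -[leRHS]addr0 -(mulr0 c).
  by apply: bellman_leD => // x y; rewrite addr0.
pose post := [set h | V h /\ forall s s', h s s' <= F h s s'].
have B0 : 0 <= B.
  have /card_gt0P[s _] := state_nonempty M.
  have /card_gt0P[a _] := action_nonempty M.
  by rewrite divr_ge0 ?subr_ge0 ?(ltW c_lt1)//; exact: le_trans (reward_gap_ge s s a).
(* The least element of [V] is a post-fixed point because [F] preserves [V]; it makes each set
   [E s s'] non-empty. *)
have post0 : post (fun _ _ => - B).
  have VB : V (fun _ _ => - B) by move=> s s'; rewrite normrN ger0_norm.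
  by split=> // s s'; have := FV _ VB s s'; rewrite ler_norml => /andP[].
pose E s s' := [set h s s' | h in post].
have E0 s s' : E s s' !=set0 by exists (- B); exists (fun _ _ => - B).
have EB s s' : ubound (E s s') B.
  by move=> _ [h [Vh _] <-]; have := Vh s s'; rewrite ler_norml => /andP[].
pose d s s' := sup (E s s').
have d_ge h : post h -> forall s s', h s s' <= d s s'.
  move=> hpost s s'; apply: ub_le_sup; first by exists B; exact: EB.
  by exists h.
have Vd : V d.
  move=> s s'; rewrite ler_norml (d_ge _ post0)/=.
  by apply: sup_le_ub; [exact: E0|exact: EB].
have dF s s' : d s s' <= F d s s'.
  apply: sup_le_ub; first exact: E0.
  by move=> _ [h hpost <-]; apply: le_trans (hpost.2 s s') _; exact/monoF/d_ge.
(* By monotonicity [F d] is again a post-fixed point, so it lies below the supremum [d]. *)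
exists d; split=> //; apply/funext => s; apply/funext => s'; apply/eqP.
rewrite eq_le dF andbT; apply: d_ge; split; first exact: FV.
exact: monoF.
Qed.

(** Split [d - h] as [(F d - F h) + (F h - h)], where [F] is the operator for [T]; the first part
    has norm at most [c] times that of [d - h] and is absorbed on the left. *)
Lemma bellman_fixpoint_dist T d h : (forall s a, Defs.distribution (T s a)) ->
  bellman M c T d = d ->
  unif_norm (fun s s' => d s s' - h s s') <=
  (1 - c)^-1 * unif_norm (fun s s' => bellman M c T h s s' - h s s').
Proof.
move=> dT dE; have S0 := state_nonempty M.
rewrite ler_pdivlMl ?subr_gt0// mulrBl mul1r lerBlDl.
apply: unif_norm_le => // s s'.
have := bellman_contraction d h dT; rewrite dE => le1.
rewrite -(subrKA (bellman M c T h s s')) (le_trans (ler_normD _ _))// lerD//.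
  by apply: le_trans le1; exact: (unif_norm_ge S0 (fun s s' => d s s' - _ s s')).
exact: (unif_norm_ge S0 (fun s s' => _ s s' - h s s')).
Qed.

Lemma bellman_fixpoint_unique T : (forall s a, Defs.distribution (T s a)) ->
  exists! h, is_fixpoint V (bellman M c T) h.
Proof.
move=> dT; have [d [Vd Fd]] := bellman_fixpoint_exists dT.
exists d; split=> // h [_ Fh]; apply/funext => s; apply/funext => s'.
apply/eqP; rewrite -subr_eq0 -normr_le0.
have S0 := state_nonempty M.
apply: le_trans (unif_norm_ge S0 (fun s s' => d s s' - h s s') s s') _.
(* The residual of the second fixed point [h] is zero, so its distance to [d] is too. *)
apply: le_trans (bellman_fixpoint_dist h dT Fd) _; rewrite Fh.
rewrite pmulr_rle0 ?invr_gt0 ?subr_gt0//.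
by apply: unif_norm_le => // x y; rewrite subrr normr0.
Qed.

Lemma bellman_iter_dist T d h n : (forall s a, Defs.distribution (T s a)) ->
  bellman M c T d = d ->
  unif_norm (fun s s' => d s s' - iter n (bellman M c T) h s s') <=
  c ^+ n / (1 - c) * unif_norm (fun s s' => bellman M c T h s s' - h s s').
Proof.
move=> dT dE; elim: n => [|n IHn].
  by rewrite expr0 mul1r; exact: bellman_fixpoint_dist.
rewrite exprS -[c * _ / _]mulrA -mulrA -[in leLHS]dE.
apply: le_trans (bellman_contraction _ _ dT) _.
by rewrite ler_pM2l.
Qed.

End bellman.

(** * A strong law of large numbers for pairwise independent events *)

Lemma mean_cvg0_along_squares (R : realType) (Y : nat -> R) :
  (forall k, `|Y k| <= 1) ->
  (fun m => (m.+1 ^ 2)%:R^-1 * \sum_(k < m.+1 ^ 2) Y k) @ \oo --> (0 : R) ->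
  (fun n => n%:R^-1 * \sum_(k < n) Y k) @ \oo --> (0 : R).
Proof.
move=> Y1 Ysq.
set u := (X in X @ \oo --> _) in Ysq.
(* This dominates the mean at each [n] from [m.+1 ^ 2] up to, but excluding, [m.+2 ^ 2]: the at most
   [2 * m.+1] terms after the square contribute at most [2 * m.+1 / n], hence at most [2 / m.+1]. *)
have {Ysq} bound0 : (fun m => `|u m| + 2 * harmonic m) @ \oo --> (0 : R).
  rewrite (_ : 0 = `|0 : R| + 2 * 0); last by rewrite normr0 mulr0 addr0.
  apply: cvgD; first exact: cvg_norm.
  by apply: cvgMl_tmp; exact: cvg_harmonic.
apply/cvgr0Pnorm_lt => e e0.
have [N _ uN] := (cvgr0Pnorm_lt _).1 bound0 e e0.
(* From here on, the largest [m] with [m.+1 ^ 2 <= n] exists and is at least [N]. *)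
exists (N.+1 ^ 2)%N => // n /= Nn.
have [m [mn nm]] : exists m, (m.+1 ^ 2 <= n /\ n < m.+2 ^ 2)%N.
  have [m mn mmax] : exists2 m, (m.+1 ^ 2 <= n)%N &
      forall k, (k.+1 ^ 2 <= n -> k <= m)%N.
    have ex : exists k, (k.+1 ^ 2 <= n)%N by exists N.
    have ub k : (k.+1 ^ 2 <= n -> k <= n)%N by nia.
    by case: (ex_maxnP ex ub) => m ? ?; exists m.
  by exists m; split=> //; rewrite ltnNge; apply/negP => /mmax; lia.
have Nm : (N <= m)%N by nia.
have n0 : (0 : R) < n%:R by rewrite ltr0n; nia.
have m0 : (0 : R) < (m.+1 ^ 2)%:R by rewrite ltr0n; nia.
apply: le_lt_trans (uN m Nm); apply: le_trans (ler_norm _).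
have -> : \sum_(k < n) Y k =
    \sum_(k < m.+1 ^ 2) Y k + \sum_(m.+1 ^ 2 <= k < n) Y k.
  by rewrite -!(big_mkord xpredT) -(big_cat_nat _ mn).
rewrite mulrDr (le_trans (ler_normD _ _))// lerD//.
  rewrite !normrM ler_wpM2r// !ger0_norm ?invr_ge0// lef_pV2 ?posrE//.
  by rewrite ler_nat.
rewrite normrM ger0_norm ?invr_ge0// ler_pdivrMl//.
apply: (@le_trans _ _ (n - m.+1 ^ 2)%:R).
  apply: le_trans (ler_norm_sum _ _ _) _.
  apply: (@le_trans _ _ (\sum_(m.+1 ^ 2 <= k < n) 1)); first exact: ler_sum.
  by rewrite big_const_nat iter_addr addr0.
rewrite /harmonic mulrA ler_pdivlMr// -!natrM ler_nat; nia.
Qed.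

Section second_moment.
Context d (Omega : measurableType d) (R : realType) (Pr : probability Omega R).
Variables (A : nat -> set Omega) (p : R).
Hypothesis mA : forall k, measurable (A k).
Hypothesis PA : forall k, Pr (A k) = p%:E.
Hypothesis PAA : forall j k, j != k -> Pr (A j `&` A k) = (p ^+ 2)%:E.

Let Y k w : R := \1_(A k) w - p.

Let p01 : 0 <= p <= 1.
Proof. by rewrite -!lee_fin -(PA 0) measure_ge0 probability_le1. Qed.

Let mY k : measurable_fun setT (Y k).
Proof.
rewrite (_ : Y k = (\1_(A k) \+ cst (- p)))//; apply: measurable_funD => //.
Qed.

Let Y1 k w : `|Y k w| <= 1.
Proof.
rewrite /Y indicE ler_norml; have /andP[] := p01.
by case: (_ \in _) => /=; lra.
Qed.

Let integrableYY j k : Pr.-integrable setT (fun w => (Y j w * Y k w)%:E).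
Proof.
apply: (@measurable_bounded_integrable _ _ _ Pr (fun w => Y j w * Y k w)) => //.
- by rewrite (le_lt_trans (probability_le1 _ _))// ltry.
- exact: measurable_funM.
- exists 1; split=> // x x1 w _ /=; rewrite (le_trans _ (ltW x1))//.
  by rewrite normrM mulr_ile1.
Qed.

(** The covariances of the indicators: expand the product of the centred indicators and integrate
    term by term. *)
Let integralYY j k :
  (\int[Pr]_w (Y j w * Y k w)%:E = if j == k then (p - p ^+ 2)%:E else 0)%E.
Proof.
have -> : (fun w => (Y j w * Y k w)%:E) = (fun w => (\1_(A j `&` A k) w)%:E +
    ((- p)%:E * (\1_(A j) w)%:E + ((- p)%:E * (\1_(A k) w)%:E + (p ^+ 2)%:E)))%E.
  apply/funext => w; rewrite -!EFinM -!EFinD indicI /Y; congr EFin.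
  by rewrite /=; ring.
have iI B : measurable B -> Pr.-integrable setT (fun w => (\1_B w)%:E).
  exact: integrable_indic.
have iC : Pr.-integrable setT (fun=> (p ^+ 2)%:E).
  exact: finite_measure_integrable_cst.
have i2 : Pr.-integrable setT (fun w => (- p)%:E * (\1_(A k) w)%:E + (p ^+ 2)%:E)%E.
  by apply: integrableD => //; apply: integrableZl => //; exact: iI.
have i1 : Pr.-integrable setT (fun w => (- p)%:E * (\1_(A j) w)%:E +
    ((- p)%:E * (\1_(A k) w)%:E + (p ^+ 2)%:E))%E.
  by apply: integrableD => //; apply: integrableZl => //; exact: iI.
have mAA := measurableI _ _ (mA j) (mA k).
rewrite integralD//; last exact: iI.
rewrite integralD//; last by apply: integrableZl => //; exact: iI.
rewrite integralD//; last by apply: integrableZl => //; exact: iI.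
rewrite !integralZl//; [|exact: iI..].
rewrite integral_cst//= probability_setT mule1.
rewrite !integral_indic// !setIT/= !PA.
have [<-|jk] := eqVneq j k.
  by rewrite setIid PA -!EFinM -!EFinD; congr EFin; ring.
by rewrite PAA// -!EFinM -!EFinD; congr EFin; ring.
Qed.

(** Only the [n] diagonal terms of the expanded square survive, each equal to the variance
    [p - p ^+ 2], which is at most 1. *)
Lemma second_moment_le n :
  (\int[Pr]_w ((\sum_(k < n) (\1_(A k) w - p)) ^+ 2)%:E <= n%:R%:E)%E.
Proof.
have -> : (fun w => ((\sum_(k < n) (\1_(A k) w - p)) ^+ 2)%:E) =
    (fun w => \sum_(j < n) \sum_(k < n) (Y j w * Y k w)%:E)%E.
  apply/funext => w; rewrite expr2 mulr_suml -sumEFin; apply: eq_bigr => j _.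
  by rewrite mulr_sumr -sumEFin.
rewrite integral_sum//; last first.
  by move=> j; apply: integrable_sum => // k _; exact: integrableYY.
rewrite (eq_bigr (fun=> (p - p ^+ 2)%:E)) => [|j _]; last first.
  rewrite integral_sum//; under eq_bigr do rewrite integralYY eq_sym.
  by rewrite -big_mkcond/= (big_pred1 j).
rewrite sumEFin lee_fin sumr_const card_ord -[leLHS]mulr_natl.
by rewrite ler_piMr//; have /andP[] := p01; nra.
Qed.

Let dev m w : R := ((m.+1 ^ 2)%:R^-1 * \sum_(k < m.+1 ^ 2) Y k w) ^+ 2.

Let mdev m : measurable_fun setT (fun w => (dev m w)%:E).
Proof.
apply/measurable_EFinP; apply: measurable_funX; apply: measurable_funM => //.
exact: measurable_sum.
Qed.

(** The second moment gives the bound [1 / m.+1 ^ 2], which is weakened to [2 / (m.+1 * m.+2)] so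
    that the series telescopes. *)
Let integral_dev m :
  (\int[Pr]_w (dev m w)%:E <= (2 * (m.+1%:R^-1 - m.+2%:R^-1))%:E)%E.
Proof.
have a0 : (0 : R) < (m.+1 ^ 2)%:R by rewrite ltr0n expn_gt0.
under eq_integral do rewrite /dev exprMn EFinM.
rewrite ge0_integralZl_EFin//; last 2 first.
- by move=> w _; rewrite lee_fin sqr_ge0.
- apply/measurable_EFinP; apply: measurable_funX; exact: measurable_sum.
apply: le_trans (lee_wpmul2l _ (second_moment_le _)) _.
  by rewrite lee_fin sqr_ge0.
rewrite -EFinM lee_fin expr2 -mulrA mulVf ?gt_eqF// mulr1.
have m1 : (0 : R) < m.+1%:R by rewrite ltr0n.
have m2 : (0 : R) < m.+2%:R by rewrite ltr0n.
rewrite (_ : _ - _ = (m.+1%:R * m.+2%:R)^-1); last first.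
  move: m1 m2; rewrite -[m.+2%:R]natr1; move: (m.+1%:R : R) => x x0 x1.
  by field; rewrite !gt_eqF.
rewrite ler_pdivlMr ?mulr_gt0// ler_pdivrMl//.
by rewrite -!natrM ler_nat; nia.
Qed.

(** The series of the [dev m] has finite expectation, so it converges almost everywhere and its
    terms tend to 0 there; this is convergence of the means along squares. *)
Lemma pairwise_independent_slln :
  {ae Pr, forall w, (fun n => n%:R^-1 * \sum_(k < n) (\1_(A k) w - p)) @ \oo -->
    (0 : R)}.
Proof.
have int_fin : (\int[Pr]_w (\sum_(m <oo) (dev m w)%:E) <= 2%:E)%E.
  rewrite integral_nneseries//; last first.
    by move=> m w _; rewrite lee_fin sqr_ge0.
  apply: lime_le.
    apply: is_cvg_nneseries => m _ _.
    by apply: integral_ge0 => w _; rewrite lee_fin sqr_ge0.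
  (* The bounds of the first [n] terms telescope to [2 * (1 - n.+1%:R^-1)]. *)
  apply: nearW => n; apply: le_trans (lee_sum _ (fun m _ => integral_dev m)) _.
  rewrite sumEFin lee_fin -mulr_sumr -[leRHS]mulr1 ler_wpM2l//.
  under eq_bigr do rewrite -opprB.
  rewrite sumrN (telescope_sumr (fun i => i.+1%:R^-1))// opprB invr1.
  by rewrite lerBlDr lerDl invr_ge0.
have : Pr.-integrable setT (fun w => \sum_(m <oo) (dev m w)%:E)%E.
  apply/integrableP; split.
    by apply: ge0_emeasurable_sum => // m w _; rewrite lee_fin sqr_ge0.
  under eq_integral.
    move=> w _; rewrite gee0_abs; last first.
      by apply: nneseries_ge0 => m _ _; rewrite lee_fin sqr_ge0.
    over.
  exact: le_lt_trans int_fin (ltry _).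
move=> /(integrable_ae measurableT); apply: filterS => w /(_ I) fin.
have : (fun m => dev m w) @ \oo --> (0 : R).
  apply: cvg_series_cvg_0.
  apply: (@summable_cvg R xpredT (fun m => (dev m w)%:E)).
    by move=> m _; rewrite lee_fin sqr_ge0.
  rewrite /summable -(nneseries_esum (P := xpredT))//.
  under eq_eseriesr do rewrite gee0_abs ?lee_fin ?sqr_ge0//.
  by move: fin; rewrite fin_numElt => /andP[].
move=> dev0; apply: (@mean_cvg0_along_squares R (fun k => \1_(A k) w - p)).
  by move=> k; exact: Y1.
apply/cvgr0Pnorm_lt => e e0.
(* As [dev] is the square of the mean, the threshold for it is [e ^+ 2]. *)
have dev_lt : \forall m \near \oo, `|dev m w| < e ^+ 2.
  by apply: (cvgr0Pnorm_lt _).1 dev0 _ _; exact: exprn_gt0.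
apply: filterS dev_lt => m; rewrite /dev ger0_norm ?sqr_ge0// -real_normK ?num_real//.
by rewrite ltr_pXn2r// ?nnegrE// ltW.
Qed.

End second_moment.

(** * Convergence of the empirical distributions and of their fixed points *)

Lemma empirical_ae_cvg (R : realType) (S : finType) d (Omega : measurableType d)
    (Pr : probability Omega R) (p : S -> R) (X : nat -> Omega -> S) x :
  iid_samples Pr p X ->
  {ae Pr, forall w, (fun n => empirical R X n w x) @ \oo --> p x}.
Proof.
move=> [mX lawX indepX].
have PXX j k : j != k ->
    Pr ((X j @^-1` [set x]) `&` (X k @^-1` [set x])) = (p x ^+ 2)%:E.
  (* Pairwise independence is the case of a two-element list, duplicate-free because [j != k]. *)
  move=> jk; have /(_ (fun=> [set x])) := indepX [:: j; k].
  rewrite /= inE jk => /(_ isT).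
  rewrite !big_cons big_nil mulr1 !lawX /= => <-.
  congr (Pr _); apply/seteqP; split=> w /=.
    by move=> [wj wk] i /=; rewrite !inE => /orP[]/eqP->.
  by move=> wjk; split; apply: wjk; rewrite /= !inE eqxx ?orbT.
apply: filterS (pairwise_independent_slln (fun k => mX k x) (fun k => lawX k x) PXX).
move=> w mean0; apply/cvgrPdist_lt => e e0.
have [N _ meanN] := (cvgr0Pnorm_lt _).1 mean0 e e0.
(* Starting at [N.+1] keeps [n] positive, so that averaging [n] copies of [p x] gives back [p x]. *)
exists N.+1 => // n /= Nn; apply: le_lt_trans (meanN n (ltnW Nn)).
rewrite distrC /empirical sumrB mulrBr sumr_const card_ord -[p x *+ n]mulr_natl.
have n0 : n%:R != 0 :> R by rewrite pnatr_eq0 -lt0n (leq_trans _ Nn).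
rewrite mulKf// (eq_bigr (fun k : 'I_n => \1_(X k @^-1` [set x]) w)) // => k _.
rewrite indicE; congr (nat_of_bool _)%:R; apply/eqP/idP.
  by move=> Xk; rewrite inE.
by rewrite inE.
Qed.

Lemma empirical_distribution (R : realType) (S : finType) (Omega : Type)
    (X : nat -> Omega -> S) n w : (0 < n)%N ->
  Defs.distribution (empirical R X n w).
Proof.
move=> n0; split=> [x|]; first by rewrite mulr_ge0 ?invr_ge0 ?sumr_ge0.
rewrite -mulr_sumr exchange_big/=.
rewrite (eq_bigr (fun=> 1)) => [|k _].
  by rewrite sumr_const card_ord mulVf// pnatr_eq0 -lt0n.
by rewrite (bigD1 (X k w))//= eqxx big1 ?addr0// => x /negbTE; rewrite eq_sym => ->.
Qed.

Theorem theorem5p2 (R : realType) (S A : finType) (M : mdp R S A) (c : R)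
    (c_gt0 : 0 < c) (c_lt1 : c < 1)
    (d : measure_display) (Omega : measurableType d)
    (Pr : probability Omega R) (X : S -> A -> nat -> Omega -> S)
    (X_iid : forall s a, iid_samples Pr (trans M s a) (X s a)) :
  let V := bounded_by (reward_gap M / (1 - c)) in
  let F := bellman M c (trans M) in
  let Fi := fun (i : nat) (w : Omega) =>
    bellman M c (fun s a => empirical R (X s a) i w) in
  [/\ forall (i : nat) (w : Omega), (0 < i)%N ->
        set_fun V V (Fi i w) /\ exists! di, is_fixpoint V (Fi i w) di,
      forall (i : nat) (w : Omega) (di : S -> S -> R), (0 < i)%N ->
        is_fixpoint V (Fi i w) di ->
        forall (h0 : S -> S -> R) (n : nat), V h0 ->
          unif_norm (fun s s' => di s s' - iter n (Fi i w) h0 s s') <=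
          c ^+ n / (1 - c) * unif_norm (fun s s' => Fi i w h0 s s' - h0 s s') &
      set_fun V V F /\ exists dfix : S -> S -> R,
        unique (is_fixpoint V F) dfix /\
        forall di : nat -> Omega -> S -> S -> R,
          (forall (i : nat) (w : Omega), (0 < i)%N ->
             is_fixpoint V (Fi i w) (di i w)) ->
          {ae Pr, forall w,
             (fun i => unif_norm (fun s s' => di i w s s' - dfix s s'))
               @ \oo --> (0 : R)}].
Proof.
move=> V F Fi.
have dF : forall s a, Defs.distribution (trans M s a) := trans_distribution M.
have dFi i w : (0 < i)%N ->
    forall s a, Defs.distribution (empirical R (X s a) i w).
  by move=> i0 s a; exact: empirical_distribution.
split.
- move=> i w i0; split; first by apply: bellman_bounded => //; exact: dFi.
  by apply: bellman_fixpoint_unique => //; exact: dFi.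
- by move=> i w di i0 [_ Fdi] h0 n _; apply: bellman_iter_dist => //; exact: dFi.
split; first exact: bellman_bounded.
have [dfix [[Vdfix Fdfix] dfixU]] := bellman_fixpoint_unique (M := M) c_gt0 c_lt1 dF.
exists dfix; split; first by split.
move=> di fixdi.
(* There are finitely many triples of state, action and target, so the exceptional null sets combine
   into one. *)
have : {ae Pr, forall w, forall t : S * A * S,
    (fun i => empirical R (X t.1.1 t.1.2) i w t.2) @ \oo --> trans M t.1.1 t.1.2 t.2}.
  by apply: filter_forall => t; exact: empirical_ae_cvg (X_iid t.1.1 t.1.2).
apply: filterS => w emp.
(* Summing over all pairs gives a single null sequence that dominates every l^1 error. *)
pose err i := \sum_(t : S * A) \sum_x
  `|empirical R (X t.1 t.2) i w x - trans M t.1 t.2 x|.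
pose b := reward_gap M / (1 - c).
(* The fixed-point estimate at [dfix] gives the factor [(1 - c)^-1]; the rest bounds the residual of
   [dfix] under [Fi i w] by perturbation, as [F dfix = dfix]. *)
have err0 : (fun i => (1 - c)^-1 * (c * (4 * b * err i))) @ \oo --> (0 : R).
  rewrite -(mulr0 (1 - c)^-1) -(mulr0 c) -(mulr0 (4 * b)).
  do 3!apply: cvgMl_tmp.
  have sum0 (I : finType) (f : I -> nat -> R) :
      (forall k, f k @ \oo --> (0 : R)) -> (fun i => \sum_k f k i) @ \oo --> (0 : R).
    move=> f0; have := @cvg_big _ _ +%R 0 xpredT (@add_continuous R) _ \oo
      (index_enum I) f (fun=> 0) _ (fun k _ => f0 k).
    by rewrite big1_eq; apply.
  apply: (sum0 _ (fun t i =>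
    \sum_x `|empirical R (X t.1 t.2) i w x - trans M t.1 t.2 x|)) => t.
  apply: (sum0 _ (fun x i =>
    `|empirical R (X t.1 t.2) i w x - trans M t.1 t.2 x|)) => x.
  rewrite -(normr0 R) -(subrr (trans M t.1 t.2 x)).
  apply: cvg_norm; apply: cvgB; last exact: cvg_cst.
  exact: (emp (t, x)).
apply: squeeze_cvgr (cvg_cst 0) err0.
(* Index 0 is left out: with no samples the empirical function is zero, not a distribution. *)
exists 1%N => // i /= i0.
have [_ Fdi] := fixdi i w i0.
rewrite unif_norm_ge0 ?(state_nonempty M)//=.
apply: le_trans (bellman_fixpoint_dist c_gt0 c_lt1 dfix (dFi i w i0) Fdi) _.
rewrite ler_pM2l ?invr_gt0 ?subr_gt0//.
have le_err s a : \sum_x `|empirical R (X s a) i w x - trans M s a x| <= err i.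
  by rewrite /err (bigD1 (s, a))//= lerDl !sumr_ge0// => t _; rewrite sumr_ge0.
have := bellman_perturb (M := M) c_gt0 (dFi i w i0) dF Vdfix le_err.
by rewrite Fdfix.
Qed.
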